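(* Let $0<z<\frac{\pi}{6}$ and $-1<a<1$. Then $$\sum_{n=1}^\infty \frac{\left(1-e^{-2iz}\right)^n}{n+a} = 2i\int_0^z \exp\left(a\left[\log\left(\frac{\sin t}{\sin z}\right)+i(z-t)\right]\right)dt.$$
   Context: Here $i$ is the imaginary unit, $t$ is a real integration variable, and $\log$ is the (principal) real logarithm of the positive number $\sin t/\sin z$. For $a<0$ the integral is an (absolutely convergent) improper integral at $t=0$. *)

(* Defs.v *)
From Stdlib Require Import Reals.
From Coquelicot Require Import Coquelicot.

Open Scope R_scope.

(* Coquelicot's [Complex] has no exponential: exp (x + i y) = exp x (cos y + i sin y). *)
Definition Cexp (w : C) : C :=
  (RtoC (exp (Re w)) * (RtoC (cos (Im w)) + Ci * RtoC (sin (Im w))))%C.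

Definition integrand (a z t : R) : C :=
  Cexp (RtoC a * (RtoC (ln (sin t / sin z)) + Ci * RtoC (z - t)))%C.

(* Term of index n >= 1 of the series. *)
Definition series_term (a z : R) (n : nat) : C :=
  (Cpow (RtoC 1 - Cexp (- (RtoC 2 * Ci * RtoC z))) n / RtoC (INR n + a))%C.

(* Main.v *)
Require Import Defs.
From Stdlib Require Import Reals Lra.
From Coquelicot Require Import Coquelicot.
Open Scope R_scope.

(** Put [w(t) = 1 - exp(-2it) = 2i sin t exp(-it)].  Then
    [w(t) / w(z) = (sin t / sin z) exp(i(z - t))], so [integrand c z t] is the
    power [(w(t) / w(z))^c] for every real [c], and substituting [w] for [t]
    turns the right-hand side into the integral of [(w / w(z))^a / (1 - w)]
    from [0] to [w(z)], since [dw = 2i (1 - w) dt].  Expanding [1 / (1 - w)]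
    in powers of [w], which is possible because [|w(z)| = 2 sin z < 1], gives
    the series.

    The proof is this computation carried out by telescoping.  Let
      [J_n = int_0^z w(z)^n (w(t) / w(z))^(n + a) dt
           = int_0^z w(t)^n (w(t) / w(z))^a dt]
    ([moment]).  From [w' = 2i (1 - w)], the function
    [w(z)^(n+1) (w / w(z))^(n+1+a) / (2i (n + 1 + a))] is an antiderivative of
    the difference of the integrands of [J_n] and [J_(n+1)].  It vanishes at
    [0+] because [n + 1 + a > 0], hence
      [w(z)^(n+1) / (n + 1 + a) = 2i (J_n - J_(n+1))]
    ([series_term_moment]), and the partial sums of the series are
    [2i (J_0 - J_N)].  Since [|w(t)| <= 2 sin z] on [(0, z]], [J_N] is at most
    [(2 sin z)^N] times the integral of [|integrand a z|]
    ([Cmod_moment_le]), which tends to [0].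

    All improper integrals converge for the same reason
    ([ex_RInt_gen_dominated_sin_power]): their integrands are bounded by a
    multiple of [(sin t / sin z)^c] with [c > -1], and on [(0, pi/6)], where
    [cos] is at least [1/2], this is at most the derivative of a multiple of
    [(sin t / sin z)^(c+1)], which has a limit at [0+]. *)

(** * Improper integrals at the left end of an interval *)

Lemma at_right_le (a b : R) : a < b -> at_right a (fun u => a < u <= b).
Proof.
  intros Hab.
  exists (mkposreal (b - a) (proj2 (Rlt_0_minus a b) Hab)); intros y Hy Hay.
  apply Rabs_def2 in Hy. unfold minus, plus, opp in Hy; simpl in Hy. lra.
Qed.

(** The fundamental theorem of calculus on [(a, b]]: the limit [l] takes the
    place of the value of [F] at [a], where [F] may be singular. *)
Lemma is_RInt_gen_derive_at_right {V : CompleteNormedModule R_AbsRing}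
  (F f : R -> V) (a b : R) (l : V) :
  a < b ->
  (forall x, a < x <= b -> is_derive F x (f x)) ->
  (forall x, a < x <= b -> continuous f x) ->
  filterlim F (at_right a) (locally l) ->
  is_RInt_gen f (at_right a) (at_point b) (minus (F b) l).
Proof.
  intros Hab Hd Hc Hl.
  assert (Hlim : filterlim (fun ab : R * R => minus (F b) (F (fst ab)))
    (filter_prod (at_right a) (at_point b)) (locally (minus (F b) l))).
  { unfold minus.
    apply (filterlim_comp_2 (G := locally (F b)) (H := locally (opp l))).
    - apply filterlim_const.
    - eapply filterlim_comp; [| apply (@filterlim_opp R_AbsRing V l)].
      eapply filterlim_comp; [apply filterlim_fst | exact Hl].
    - apply (@filterlim_plus R_AbsRing V). }
  apply (filterlimi_lim_ext_loc (fun ab : R * R => minus (F b) (F (fst ab)))).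
  2: exact Hlim.
  exists (fun u => a < u <= b) (fun v => v = b).
  - now apply at_right_le.
  - reflexivity.
  - intros x y Hx ->; simpl.
    apply (is_RInt_derive F f x b); intros u;
      rewrite Rmin_left, Rmax_right by lra; intros Hu;
      [apply Hd | apply Hc]; lra.
Qed.

Lemma minus_plus_r {G : AbelianGroup} (x y : G) : minus (plus x y) y = x.
Proof.
  transitivity (plus x (plus y (opp y))).
  - symmetry; apply (plus_assoc (G := G)).
  - transitivity (plus x zero); [| apply plus_zero_r].
    apply f_equal, plus_opp_r.
Qed.

(** Domination by a derivative [dh] makes the increments of
    [u |-> int_u^b f] at most those of [h]; as [h] has a limit at [a], Cauchy's
    criterion passes from [h] to the integral.  Stating it for a complete
    normed space covers both the integral of a complex function and that of
    its modulus. *)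
Lemma ex_RInt_gen_dominated_at_right {V : CompleteNormedModule R_AbsRing}
  (f : R -> V) (h dh : R -> R) (a b l : R) :
  a < b ->
  (forall x, a < x <= b -> continuous f x) ->
  (forall x, a < x <= b -> is_derive h x (dh x)) ->
  (forall x, a < x <= b -> continuous dh x) ->
  (forall x, a < x <= b -> norm (f x) <= dh x) ->
  filterlim h (at_right a) (locally l) ->
  ex_RInt_gen f (at_right a) (at_point b).
Proof.
  intros Hab Hcf Hd Hc Hle Hl.
  assert (Hnear : at_right a (fun u => a < u <= b)).
  { now apply at_right_le. }
  assert (Hex : forall u v, a < u <= b -> a < v <= b -> ex_RInt f u v).
  { intros u v Hu Hv. apply ex_RInt_continuous. intros x Hx. apply Hcf.
    revert Hx; unfold Rmin, Rmax; destruct (Rle_dec u v); lra. }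
  assert (Hinc : forall u v, a < u <= b -> a < v <= b ->
    norm (RInt f u v) <= Rabs (h v - h u)).
  { assert (Hinc' : forall u v, a < u <= b -> a < v <= b -> u <= v ->
      norm (RInt f u v) <= Rabs (h v - h u)).
    { intros u v Hu Hv Huv.
      eapply Rle_trans; [|apply Rle_abs].
      apply (norm_RInt_le f dh u v _ (h v - h u) Huv).
      - intros x Hx; apply Hle; lra.
      - apply RInt_correct, Hex; assumption.
      - apply (is_RInt_derive h dh u v); intros x;
          rewrite Rmin_left, Rmax_right by lra; intros Hx;
          [apply Hd | apply Hc]; lra. }
    intros u v Hu Hv. destruct (Rle_or_lt u v) as [H | H].
    - now apply Hinc'.
    - rewrite <- (opp_RInt_swap f) by (apply Hex; assumption).
      rewrite Rabs_minus_sym.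
      eapply Rle_trans; [apply Req_le, (norm_opp (RInt f v u)) |].
      apply Hinc'; lra. }
  destruct (proj1 (filterlim_locally_cauchy (F := at_right a)
    (fun u => RInt f u b))) as [I HI].
  { intros eps.
    destruct (proj2 (filterlim_locally_cauchy (F := at_right a) h)
      (ex_intro _ l Hl) eps) as [P [HP HPP]].
    exists (fun u => P u /\ a < u <= b).
    split; [now apply filter_and |].
    intros u v [Pu Hu] [Pv Hv]. apply (@norm_compat1 R_AbsRing V).
    assert (E : minus (RInt f v b) (RInt f u b) = RInt f v u).
    { rewrite <- (RInt_Chasles f v u b) by (apply Hex; lra).
      exact (minus_plus_r (G := V) (RInt f v u) (RInt f u b)). }
    eapply Rle_lt_trans; [exact (Req_le _ _ (f_equal norm E)) |].
    eapply Rle_lt_trans; [now apply Hinc |].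
    specialize (HPP _ _ Pv Pu). exact HPP. }
  exists I.
  apply (filterlimi_lim_ext_loc (fun ab : R * R => RInt f (fst ab) b)).
  - exists (fun u => a < u <= b) (fun v => v = b); [exact Hnear | reflexivity |].
    intros x y Hx ->; simpl. apply RInt_correct, Hex; lra.
  - apply (filterlim_comp _ _ _ fst (fun u => RInt f u b) _ (at_right a));
      [apply filterlim_fst | exact HI].
Qed.

(** * Complex powers along the chord *)

Lemma is_derive_C (f1 f2 : R -> R) (x l1 l2 : R) :
  is_derive f1 x l1 -> is_derive f2 x l2 ->
  is_derive (V := C_R_NormedModule) (fun t => (f1 t, f2 t)) x (l1, l2).
Proof.
  intros H1 H2.
  pose proof (is_derive_plus (V := C_R_NormedModule) _ _ x _ _
    (is_derive_scal_l (V := C_R_NormedModule) f1 x l1 (1, 0) H1)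
    (is_derive_scal_l (V := C_R_NormedModule) f2 x l2 (0, 1) H2)) as H.
  replace (l1, l2) with
    (@plus C_R_NormedModule (scal l1 (1, 0)) (scal l2 (0, 1))).
  - eapply is_derive_ext; [| exact H].
    intros t. apply injective_projections; simpl;
      unfold plus, scal, mult; simpl; unfold mult; simpl; ring.
  - apply injective_projections; simpl;
      unfold plus, scal, mult; simpl; unfold mult; simpl; ring.
Qed.

Lemma norm_C_R (x : C) : norm (x : C_R_NormedModule) = Cmod x.
Proof.
  unfold Cmod, norm; simpl. unfold prod_norm, norm; simpl. unfold abs; simpl.
  f_equal. rewrite !Rmult_1_r, <- !Rabs_mult, !Rabs_pos_eq; trivial; nra.
Qed.

Lemma Cexp_plus (u v : C) : Cexp (u + v) = (Cexp u * Cexp v)%C.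
Proof.
  unfold Cexp; destruct u as [u1 u2], v as [v1 v2]; simpl.
  rewrite exp_plus, cos_plus, sin_plus.
  apply injective_projections; simpl; ring.
Qed.

Lemma integrand_eq (c z t : R) :
  integrand c z t =
  (exp (c * ln (sin t / sin z)) * cos (c * (z - t)),
   exp (c * ln (sin t / sin z)) * sin (c * (z - t))).
Proof.
  unfold integrand, Cexp. simpl.
  replace (c * (ln (sin t / sin z) + (0 * (z - t) - 1 * 0))
    - 0 * (0 + (0 * 0 + 1 * (z - t)))) with (c * ln (sin t / sin z)) by ring.
  replace (c * (0 + (0 * 0 + 1 * (z - t)))
    + 0 * (ln (sin t / sin z) + (0 * (z - t) - 1 * 0)))
    with (c * (z - t)) by ring.
  apply injective_projections; simpl; ring.
Qed.

Lemma integrand_plus (c d z t : R) :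
  integrand (c + d) z t = (integrand c z t * integrand d z t)%C.
Proof.
  unfold integrand. rewrite <- Cexp_plus. f_equal.
  rewrite RtoC_plus. ring.
Qed.

Lemma Cmod_integrand (c z t : R) :
  Cmod (integrand c z t) = exp (c * ln (sin t / sin z)).
Proof.
  rewrite integrand_eq; unfold Cmod; simpl.
  transitivity (sqrt (Rsqr (exp (c * ln (sin t / sin z)))));
    [| apply sqrt_Rsqr, Rlt_le, exp_pos].
  f_equal. unfold Rsqr.
  pose proof (sin2_cos2 (c * (z - t))) as H; unfold Rsqr in H.
  set (e := exp _) in *. set (p := sin (c * _)) in *. set (q := cos _) in *.
  transitivity (e * e * (p * p + q * q)); [ring | rewrite H; ring].
Qed.

Lemma integrand_diag (c z : R) : 0 < sin z -> integrand c z z = RtoC 1.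
Proof.
  intros Hz. rewrite integrand_eq.
  replace (sin z / sin z) with 1 by (field; lra).
  rewrite ln_1, Rminus_diag, !Rmult_0_r, exp_0, cos_0, sin_0.
  apply injective_projections; simpl; ring.
Qed.

(** The vector from [exp(-2it)] to [1], a chord of the unit circle; it is the
    substitution variable [w(t)]. *)
Definition chord (t : R) : C := (RtoC 1 - Cexp (- (RtoC 2 * Ci * RtoC t)))%C.

Lemma chord_eq (t : R) :
  chord t = (2 * sin t * sin t, 2 * sin t * cos t).
Proof.
  unfold chord, Cexp. simpl.
  replace (- ((2 * 0 - 0 * 1) * t - (2 * 1 + 0 * 0) * 0)) with 0 by ring.
  replace (- ((2 * 0 - 0 * 1) * 0 + (2 * 1 + 0 * 0) * t))
    with (- (2 * t)) by ring.
  rewrite exp_0, cos_neg, sin_neg, sin_2a, cos_2a_sin.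
  apply injective_projections; simpl; ring.
Qed.

Lemma Cmod_chord (t : R) : 0 <= sin t -> Cmod (chord t) = 2 * sin t.
Proof.
  intros Ht. rewrite chord_eq; unfold Cmod; simpl.
  transitivity (sqrt (Rsqr (2 * sin t))); [| apply sqrt_Rsqr; lra].
  f_equal. unfold Rsqr.
  pose proof (sin2_cos2 t) as H; unfold Rsqr in H.
  transitivity (4 * (sin t * sin t) * (sin t * sin t + cos t * cos t));
    [ring | rewrite H; ring].
Qed.

(** This is [w(z) (w(t) / w(z)) = w(t)]; together with [integrand_plus] it
    says that [integrand c z] behaves as the power [(w / w(z))^c]. *)
Lemma chord_integrand_1 (z t : R) :
  0 < sin z -> 0 < sin t -> (chord z * integrand 1 z t)%C = chord t.
Proof.
  intros Hz Ht. rewrite !chord_eq, integrand_eq.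
  rewrite !Rmult_1_l, exp_ln by now apply Rdiv_lt_0_compat.
  pose proof (sin2_cos2 z) as H; unfold Rsqr in H.
  rewrite cos_minus, sin_minus.
  apply injective_projections; simpl.
  - transitivity (2 * sin t * sin t * (sin z * sin z + cos z * cos z));
      [field; lra | rewrite H; ring].
  - transitivity (2 * sin t * cos t * (sin z * sin z + cos z * cos z));
      [field; lra | rewrite H; ring].
Qed.

(** The exponent is [c] times [log (sin t / sin z) + i(z - t)], whose
    derivative is [cot t - i].  Here [C] is a normed space over the reals, over
    which linearity only moves real scalars; so the complex factor [k] is part
    of the statement. *)
Lemma is_derive_integrand (k : C) (c z t : R) :
  0 < sin z -> 0 < sin t ->
  is_derive (V := C_R_NormedModule) (fun t => k * integrand c z t)%C t
    (k * (RtoC c * (RtoC (cos t / sin t) - Ci)) * integrand c z t)%C.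
Proof.
  intros Hz Ht. destruct k as [k1 k2].
  set (e := fun t => exp (c * ln (sin t / sin z))).
  eapply is_derive_ext with (f := fun t =>
    (e t * (k1 * cos (c * (z - t)) - k2 * sin (c * (z - t))),
     e t * (k1 * sin (c * (z - t)) + k2 * cos (c * (z - t))))).
  { intros s. rewrite integrand_eq. fold (e s).
    apply injective_projections; simpl; ring. }
  rewrite integrand_eq; fold (e t).
  assert (He : is_derive e t (c * (cos t / sin t) * e t)).
  { unfold e. auto_derive.
    - repeat split; try lra. now apply Rdiv_lt_0_compat.
    - unfold Rdiv. field. split; lra. }
  match goal with |- is_derive _ _ ?D =>
    replace D with
     (c * (cos t / sin t) * e t
          * (k1 * cos (c * (z - t)) - k2 * sin (c * (z - t)))
        + e t * (c * (k1 * sin (c * (z - t)) + k2 * cos (c * (z - t)))),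
      c * (cos t / sin t) * e t
          * (k1 * sin (c * (z - t)) + k2 * cos (c * (z - t)))
        + e t * (- c * (k1 * cos (c * (z - t)) - k2 * sin (c * (z - t)))))
  end.
  2: apply injective_projections; simpl; ring.
  apply is_derive_C.
  - apply (is_derive_mult e
      (fun t => k1 * cos (c * (z - t)) - k2 * sin (c * (z - t))));
      [exact He | | intros; apply Rmult_comm].
    auto_derive; [trivial | unfold Rminus; ring].
  - apply (is_derive_mult e
      (fun t => k1 * sin (c * (z - t)) + k2 * cos (c * (z - t))));
      [exact He | | intros; apply Rmult_comm].
    auto_derive; [trivial | unfold Rminus; ring].
Qed.

Lemma continuous_integrand (k : C) (c z t : R) :
  0 < sin z -> 0 < sin t ->
  continuous (U := C_R_NormedModule) (fun t => k * integrand c z t)%C t.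
Proof.
  intros Hz Ht.
  apply (ex_derive_continuous (V := C_R_NormedModule)).
  eexists. now apply is_derive_integrand.
Qed.

(** * Behaviour at the singular end *)

Lemma filterlim_sin_power_at_right_0 (c z : R) :
  0 < c -> 0 < sin z ->
  filterlim (fun t => exp (c * ln (sin t / sin z))) (at_right 0) (locally 0).
Proof.
  intros Hc Hz.
  assert (Hq : filterlim (fun t => sin t / sin z) (at_right 0) (at_right 0)).
  { assert (Hcont : filterlim (fun t => sin t / sin z) (at_right 0) (locally 0)).
    { eapply filterlim_filter_le_1; [apply filter_le_within |].
      replace (locally 0) with (locally (sin 0 / sin z)) at 2
        by (f_equal; rewrite sin_0; unfold Rdiv; ring).
      apply (ex_derive_continuous (fun t => sin t / sin z) 0).
      auto_derive; lra. }
    intros P HP. specialize (Hcont _ HP).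
    assert (Hpos : at_right 0 (fun t => 0 < sin t / sin z)).
    { exists (mkposreal PI PI_RGT_0). intros t Ht Ht0.
      apply Rabs_def2 in Ht. unfold minus, plus, opp in Ht; simpl in Ht.
      apply Rdiv_lt_0_compat; [apply sin_gt_0; lra | exact Hz]. }
    generalize (filter_and _ _ Hcont Hpos). apply filter_imp.
    intros t [H1 H2]. now apply H1. }
  eapply filterlim_comp; [| exact is_lim_exp_m].
  eapply filterlim_comp.
  { eapply filterlim_comp; [exact Hq | exact is_lim_ln_0]. }
  intros P [M HM]. exists (M / c). intros y Hy. apply HM.
  rewrite Rmult_comm. now apply Rlt_div_r.
Qed.

Lemma filterlim_integrand_at_right_0 (k : C) (c z : R) :
  0 < c -> 0 < sin z ->
  filterlim (U := C_R_NormedModule) (fun t => k * integrand c z t)%C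
    (at_right 0) (locally (zero : C_R_NormedModule)).
Proof.
  intros Hc Hz.
  apply (filterlim_norm_zero (V := C_R_NormedModule)).
  eapply filterlim_ext with
    (f := fun t => scal (Cmod k) (exp (c * ln (sin t / sin z)))).
  { intros t. rewrite norm_C_R, Cmod_mult, Cmod_integrand. reflexivity. }
  replace (locally 0) with (locally (scal (Cmod k) 0))
    by (f_equal; apply Rmult_0_r).
  eapply filterlim_comp; [| apply (filterlim_scal_r (Cmod k) 0)].
  now apply filterlim_sin_power_at_right_0.
Qed.

(** With [q = sin t / sin z], the derivative of
    [2 K sin z / (c+1) * q^(c+1)] is [2 cos t * K q^c], and [2 cos t >= 1] on
    [(0, pi/6)].  The condition [c > -1] makes [q^(c+1)] tend to [0]. *)
Lemma ex_RInt_gen_dominated_sin_power {V : CompleteNormedModule R_AbsRing}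
  (f : R -> V) (K c z : R) :
  0 < z < PI / 6 -> 0 <= K -> -1 < c ->
  (forall t, 0 < t <= z -> continuous f t) ->
  (forall t, 0 < t <= z -> norm (f t) <= K * exp (c * ln (sin t / sin z))) ->
  ex_RInt_gen f (at_right 0) (at_point z).
Proof.
  intros Hz HK Hc Hf Hle.
  assert (Hsin : forall t, 0 < t <= z -> 0 < sin t).
  { intros t Ht. apply sin_gt_0; lra. }
  assert (Hsz : 0 < sin z) by (apply Hsin; lra).
  apply (ex_RInt_gen_dominated_at_right f
    (fun t => 2 * K * sin z / (c + 1) * exp ((c + 1) * ln (sin t / sin z)))
    (fun t => 2 * cos t * (K * exp (c * ln (sin t / sin z)))) 0 z 0).
  - lra.
  - exact Hf.
  - intros t Ht. specialize (Hsin t Ht).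
    auto_derive.
    + repeat split; try lra. now apply Rdiv_lt_0_compat.
    + change (sin t * / sin z) with (sin t / sin z).
      replace (exp ((c + 1) * ln (sin t / sin z)))
        with (exp (c * ln (sin t / sin z)) * (sin t / sin z)).
      * field. lra.
      * rewrite Rmult_plus_distr_r, Rmult_1_l, exp_plus, (exp_ln (_ / _))
          by now apply Rdiv_lt_0_compat.
        reflexivity.
  - intros t Ht. specialize (Hsin t Ht).
    apply (ex_derive_continuous (K := R_AbsRing) (V := R_NormedModule)).
    auto_derive. repeat split; try lra. now apply Rdiv_lt_0_compat.
  - intros t Ht. eapply Rle_trans; [now apply Hle |].
    rewrite <- (Rmult_1_l (K * _)) at 1.
    apply Rmult_le_compat_r.
    + apply Rmult_le_pos; [exact HK | apply Rlt_le, exp_pos].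
    + assert (cos (PI / 3) <= cos t) by (apply cos_decr_1; lra).
      rewrite cos_PI3 in *. lra.
  - apply (filterlim_ext (fun t => scal (2 * K * sin z / (c + 1))
      (exp ((c + 1) * ln (sin t / sin z))))); [reflexivity |].
    replace (locally 0) with (locally (scal (2 * K * sin z / (c + 1)) 0))
      by (f_equal; apply Rmult_0_r).
    eapply filterlim_comp; [| apply (filterlim_scal_r (V := R_NormedModule))].
    apply filterlim_sin_power_at_right_0; lra.
Qed.

(** * Telescoping *)

(** This is [J_n]: the integrand is [w(t)^n (w(t) / w(z))^a], written so that
    the integer and the real power of [w(t) / w(z)] are merged. *)
Definition moment (a z : R) (n : nat) : C :=
  RInt_gen (V := C_R_CompleteNormedModule)
    (fun t => chord z ^ n * integrand (INR n + a) z t)%C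
    (at_right 0) (at_point z).

Lemma is_RInt_gen_moment (a z : R) (n : nat) :
  0 < z < PI / 6 -> -1 < a ->
  is_RInt_gen (V := C_R_NormedModule)
    (fun t => chord z ^ n * integrand (INR n + a) z t)%C
    (at_right 0) (at_point z) (moment a z n).
Proof.
  intros Hz Ha.
  apply (RInt_gen_correct (V := C_R_CompleteNormedModule)).
  pose proof (pos_INR n).
  apply (ex_RInt_gen_dominated_sin_power (V := C_R_CompleteNormedModule) _
    (Cmod (chord z ^ n)) (INR n + a)); try lra.
  - apply Cmod_ge_0.
  - intros t Ht. apply continuous_integrand; apply sin_gt_0; lra.
  - intros t Ht. apply Req_le.
    etransitivity; [apply norm_C_R |].
    now rewrite Cmod_mult, Cmod_integrand.
Qed.

Lemma ex_RInt_gen_Cmod_integrand (a z : R) :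
  0 < z < PI / 6 -> -1 < a ->
  ex_RInt_gen (fun t : R => Cmod (integrand a z t)) (at_right 0) (at_point z).
Proof.
  intros Hz Ha.
  apply (ex_RInt_gen_dominated_sin_power (V := R_CompleteNormedModule) _ 1 a);
    try lra.
  - intros t Ht.
    apply (continuous_ext (U := R_UniformSpace)
      (fun t => exp (a * ln (sin t / sin z)))).
    { intros s. now rewrite Cmod_integrand. }
    apply (ex_derive_continuous (K := R_AbsRing) (V := R_NormedModule)).
    assert (0 < sin t) by (apply sin_gt_0; lra).
    assert (0 < sin z) by (apply sin_gt_0; lra).
    auto_derive. repeat split; try lra. now apply Rdiv_lt_0_compat.
  - intros t Ht. apply Req_le. rewrite Rmult_1_l, <- Cmod_integrand.
    apply Rabs_pos_eq, Cmod_ge_0.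
Qed.

(** The factor [w(z)^n] contributes [(2 sin z)^n], and raising
    [sin t / sin z <= 1] to a larger power only decreases it. *)
Lemma Cmod_moment_le (a z : R) (n : nat) :
  0 < z < PI / 6 -> -1 < a ->
  Cmod (moment a z n) <= (2 * sin z) ^ n *
    RInt_gen (fun t => Cmod (integrand a z t)) (at_right 0) (at_point z).
Proof.
  intros Hz Ha.
  assert (Hsz : 0 < sin z) by (apply sin_gt_0; lra).
  rewrite <- norm_C_R.
  apply (RInt_gen_norm (V := C_R_CompleteNormedModule)
    (Fa := at_right 0) (Fb := at_point z)
    (fun t => chord z ^ n * integrand (INR n + a) z t)%C
    (fun t => scal ((2 * sin z) ^ n) (Cmod (integrand a z t)))).
  - exists (fun u => 0 < u <= z) (fun v => v = z);
      [apply at_right_le; lra | reflexivity |].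
    intros x y Hx ->; simpl; lra.
  - exists (fun u => 0 < u <= z) (fun v => v = z);
      [apply at_right_le; lra | reflexivity |].
    intros x y Hx ->; simpl; intros t Ht.
    eapply Rle_trans; [apply Req_le, norm_C_R |].
    rewrite Cmod_mult, Cmod_pow, Cmod_chord, !Cmod_integrand by lra.
    apply Rmult_le_compat_l; [apply pow_le; lra |].
    assert (Hst : 0 < sin t) by (apply sin_gt_0; lra).
    assert (Hle : ln (sin t / sin z) <= 0).
    { rewrite <- ln_1. apply ln_le; [now apply Rdiv_lt_0_compat |].
      apply (Rdiv_le_1 _ _ Hsz). apply sin_incr_1; lra. }
    pose proof (pos_INR n).
    destruct (Rle_lt_or_eq_dec ((INR n + a) * ln (sin t / sin z))
      (a * ln (sin t / sin z))) as [H1 | H1]; [nra | |].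
    + now apply Rlt_le, exp_increasing.
    + now rewrite H1; apply Rle_refl.
  - now apply is_RInt_gen_moment.
  - apply (is_RInt_gen_scal (V := R_NormedModule)).
    apply (RInt_gen_correct (V := R_CompleteNormedModule)).
    now apply ex_RInt_gen_Cmod_integrand.
Qed.

(** Integration of the derivative of [k (w / w(z))^(n+1+a)] over [(0, z]],
    with [k] the coefficient that makes this derivative equal to
    [w^n (1 - w) (w / w(z))^a]. *)
Lemma series_term_moment (a z : R) (n : nat) :
  0 < z < PI / 6 -> -1 < a ->
  series_term a z (S n) =
  (RtoC 2 * Ci * (moment a z n - moment a z (S n)))%C.
Proof.
  intros Hz Ha.
  assert (Hsz : 0 < sin z) by (apply sin_gt_0; lra).
  pose proof (pos_INR n) as Hn.
  set (c := INR n + a).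
  assert (Hc : RtoC (c + 1) <> 0%C)
    by (intros E; apply RtoC_inj in E; unfold c in E; lra).
  assert (Hi : Ci <> 0%C).
  { intros E. apply (f_equal snd) in E. simpl in E. lra. }
  assert (Hw : chord z <> 0%C).
  { intros E. apply (f_equal Cmod) in E.
    rewrite Cmod_chord, Cmod_0 in E; lra. }
  set (k := (chord z ^ S n / (RtoC 2 * Ci * RtoC (c + 1)))%C).
  assert (HI : is_RInt_gen (V := C_R_NormedModule)
    (fun t => minus (chord z ^ n * integrand (INR n + a) z t : C_R_NormedModule)%C
                    (chord z ^ S n * integrand (INR (S n) + a) z t)%C)
    (at_right 0) (at_point z) k).
  { replace k with (@minus C_R_NormedModule (k * integrand (c + 1) z z)%C zero).
    2: { rewrite integrand_diag by exact Hsz.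
      change ((k * 1 - 0)%C = k). ring. }
    apply (is_RInt_gen_derive_at_right (V := C_R_CompleteNormedModule)
      (fun t => k * integrand (c + 1) z t)%C).
    - lra.
    - intros t Ht.
      assert (Hst : 0 < sin t) by (apply sin_gt_0; lra).
      match goal with |- is_derive _ _ ?D => replace D with
        (k * (RtoC (c + 1) * (RtoC (cos t / sin t) - Ci))
          * integrand (c + 1) z t)%C end.
      { now apply is_derive_integrand. }
      rewrite S_INR. replace (INR n + 1 + a) with (c + 1) by (unfold c; ring).
      fold c. change (@minus C_R_NormedModule) with Cminus.
      rewrite integrand_plus, Cpow_S.
      (* [(log w)' = cot t - i], so this is [w' = 2i (1 - w)]. *)
      assert (Hcot : ((RtoC (cos t / sin t) - Ci) * chord t
        = RtoC 2 * Ci * (1 - chord t))%C).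
      { rewrite chord_eq. apply injective_projections; simpl.
        - field. lra.
        - pose proof (sin2_cos2 t) as H; unfold Rsqr in H.
          field_simplify; [| lra]. nra. }
      rewrite <- (chord_integrand_1 z t Hsz Hst) in Hcot.
      unfold k. rewrite Cpow_S.
      transitivity (chord z ^ n / (RtoC 2 * Ci) * integrand c z t *
        ((RtoC (cos t / sin t) - Ci) * (chord z * integrand 1 z t)))%C.
      + field. repeat split; assumption.
      + rewrite Hcot. field. assumption.
    - intros t Ht.
      apply (continuous_minus (V := C_R_NormedModule));
        apply continuous_integrand; apply sin_gt_0; lra.
    - apply filterlim_integrand_at_right_0; unfold c; lra. }
  assert (Ek : (moment a z n - moment a z (S n))%C = k).
  { rewrite <- (is_RInt_gen_unique (V := C_R_CompleteNormedModule) _ k HI).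
    symmetry. apply (is_RInt_gen_unique (V := C_R_CompleteNormedModule)).
    apply (is_RInt_gen_minus (V := C_R_NormedModule));
      now apply is_RInt_gen_moment. }
  rewrite Ek. unfold series_term. fold (chord z). rewrite S_INR.
  replace (INR n + 1 + a) with (c + 1) by (unfold c; ring).
  unfold k. field. split; assumption.
Qed.

Theorem theorem2p2 :
  forall (z a : R), 0 < z < PI / 6 -> -1 < a < 1 ->
  (* the improper integral over (0, z] converges, and does so absolutely *)
  ex_RInt_gen (V := C_R_NormedModule)
    (integrand a z) (at_right 0) (at_point z) /\
  ex_RInt_gen (fun t : R => Cmod (integrand a z t)) (at_right 0) (at_point z) /\
  is_series (K := C_AbsRing) (V := C_NormedModule)
    (fun n : nat => series_term a z (S n))
    (RtoC 2 * Ci *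
       RInt_gen (V := C_R_CompleteNormedModule)
         (integrand a z) (at_right 0) (at_point z))%C.
Proof.
  intros z a Hz [Ha _].
  assert (HI : is_RInt_gen (V := C_R_NormedModule) (integrand a z)
    (at_right 0) (at_point z) (moment a z 0)).
  { apply (is_RInt_gen_ext (V := C_R_NormedModule)
      (fun t => chord z ^ 0 * integrand (INR 0 + a) z t)%C).
    - apply filter_forall. intros _ t _.
      simpl. rewrite Rplus_0_l. ring.
    - now apply is_RInt_gen_moment. }
  split; [now exists (moment a z 0) |].
  split; [now apply ex_RInt_gen_Cmod_integrand |].
  rewrite (is_RInt_gen_unique (V := C_R_CompleteNormedModule) _ _ HI).
  set (M := RInt_gen (fun t => Cmod (integrand a z t)) (at_right 0) (at_point z)).
  assert (Hsum : forall N, sum_n (G := C_AbelianMonoid)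
      (fun n => series_term a z (S n)) N
    = (RtoC 2 * Ci * (moment a z 0 - moment a z (S N)))%C).
  { induction N as [| N IH].
    - rewrite sum_O. now apply series_term_moment.
    - rewrite sum_Sn, IH, series_term_moment by assumption.
      match goal with |- plus ?x ?y = ?w => change ((x + y)%C = w) end. ring. }
  assert (Hq : 0 <= 2 * sin z < 1).
  { assert (0 < sin z) by (apply sin_gt_0; lra).
    assert (sin z < sin (PI / 6)) by (apply sin_increasing_1; lra).
    rewrite sin_PI6 in *. lra. }
  assert (Hlim : is_lim_seq (fun N => 2 * M * (2 * sin z) ^ S N) 0).
  { replace (Finite 0) with (Rbar_mult (2 * M) 0)
      by (simpl; f_equal; ring).
    apply is_lim_seq_scal_l, (is_lim_seq_incr_1 (fun N => (2 * sin z) ^ N)).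
    apply is_lim_seq_geom. rewrite Rabs_pos_eq; lra. }
  apply is_lim_seq_spec in Hlim.
  apply (filterlim_locally (U := C_UniformSpace)). intros eps.
  destruct (Hlim eps) as [N0 HN0]. exists N0. intros N HN.
  apply (norm_compat1 (K := C_AbsRing) (V := C_NormedModule)).
  specialize (HN0 N HN). rewrite Rminus_0_r in HN0.
  apply Rle_lt_trans with (2 := HN0).
  eapply Rle_trans; [| apply Rle_abs].
  change (@norm C_AbsRing C_NormedModule) with Cmod.
  change (@minus C_NormedModule) with Cminus.
  rewrite Hsum.
  replace (RtoC 2 * Ci * (moment a z 0 - moment a z (S N))
    - RtoC 2 * Ci * moment a z 0)%C
    with (- (RtoC 2 * Ci * moment a z (S N)))%C by ring.
  rewrite Cmod_opp, !Cmod_mult, Cmod_R, Cmod_Ci, Rabs_pos_eq by lra.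
  pose proof (Cmod_moment_le a z (S N) Hz Ha) as H. fold M in H. lra.
Qed.
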